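(* Let $k\ge2$, $p_j\ge1$ ($j=1,\dots,k$) with $(p_1,\dots,p_k)\ne(1,\dots,1)$, $\widetilde\lambda\ge0$, and $\widetilde C_j>0$ for any $1\le j\le k$. Consider the system of ordinary differential inequalities $$\frac{d}{dt}f_j(t)\ge\widetilde C_jf_{j+1}(t)^{p_j}\quad(1\le j\le k-1),\qquad \frac{d}{dt}f_k(t)\ge\widetilde C_ke^{-\widetilde\lambda t}f_1(t)^{p_k},\qquad t\in[0,T).$$ If $f_j(0)\ge0$ for $j\ne2$ and $$f_2(0)>\widetilde C^{-\alpha_2}A_2^{\alpha_2/(\alpha_1P_2)}\,\widetilde C_1^{-\alpha_2Q_2/(\alpha_1P_2)},$$ then solutions $f_j$ to this system satisfy $$f_1(t)\ge\widetilde C^{-1/\alpha_1}\bigl(e^{-L_1t/Q_1}-e^{-L_1\widetilde T_0/Q_1}\bigr)^{-\alpha_1}-A_2^{-1/P_2}\,\widetilde C_1^{Q_2/P_2}f_2(0)^{Q_1/P_2},$$ where $$\widetilde T_0=-L_1^{-1}Q_1\log\Bigl(1-\widetilde C^{-1}A_2^{1/(\alpha_1P_2)}\,\widetilde C_1^{-Q_2/(\alpha_1P_2)}f_2(0)^{-1/\alpha_2}\Bigr).$$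
   Context: Definitions of the constants. For $1\le j<k$, $$P_{k-j}=\sum_{h=0}^{j}\prod_{m=0}^{h}p_{k-j+m}+1,\qquad Q_{k-j}=\sum_{h=0}^{j-1}\prod_{m=0}^{h}p_{k-j+m}+1,$$ and $P_k=p_k+1$, $Q_k=1$. The exponents are $$\alpha_j=\frac{\sum_{h=0}^{k-2}\prod_{m=0}^{h}p_{j+m}+1}{\prod_{m=1}^{k}p_m-1}$$ (with $p_i$ interpreted as $p_{i-k}$ for $i>k$), so that $$\alpha_1=\frac{Q_1}{P_1-Q_1-1},\qquad \alpha_2=\frac{P_2}{P_1-Q_1-1}.$$ For $1\le j<k$, $$A_{k-j}=P_{k-j}^{-1}\widetilde C_{k-j}\prod_{h=0}^{j-1}\bigl(P_{k-h}^{-1}\widetilde C_{k-h}\bigr)^{\prod_{\ell=k-j}^{k-h-1}p_\ell},\qquad L_{k-j}=\widetilde\lambda\prod_{m=k-j}^{k-1}p_m,$$ and $A_k=P_k^{-1}\widetilde C_k$, $L_k=\widetilde\lambda$. Equivalently, $A_{k-j}=P_{k-j}^{-1}\widetilde C_{k-j}A_{k-j+1}^{p_{k-j}}$ and $L_{k-j}=p_{k-j}L_{k-j+1}$ for $1\le j\le k-1$. Finally, $$\widetilde C=L_1^{-1}(P_1-Q_1-1)\,2^{-p_1(P_2-1)/Q_1}\,P_1^{1/Q_1}A_1^{1/Q_1}.$$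
   Formalization: The factor C̃^{-1/α₁} in the lower bound is corrected to C̃^{-α₁} (the printed bound fails at t=0, e.g. k=2, p=(1,2), C̃=4); for λ̃=0, where L₁⁻¹ and C̃ are undefined, the threshold, T̃₀ and the bound are taken as their limits as λ̃→0+. *)

(* Defs.v *)
From HB Require Import structures.
From mathcomp Require Import all_boot all_order all_algebra.
From mathcomp Require Import all_classical all_reals all_analysis.

Set Implicit Arguments.
Unset Strict Implicit.
Unset Printing Implicit Defensive.

Import Order.TTheory GRing.Theory Num.Theory.
Import numFieldNormedType.Exports.

Local Open Scope classical_set_scope.
Local Open Scope ring_scope.

(* Families indexed by 1, ..., k are functions on nat; only their values at
   these indices matter. *)

Section Constants.
Context {R : realType}.
Variables (k : nat) (p C : nat -> R) (lam : R).

(* For i = k these give P_k = p_k + 1 and Q_k = 1. *)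
Definition Pc (i : nat) : R :=
  \sum_(0 <= h < (k - i).+1) \prod_(0 <= m < h.+1) p (i + m)%N + 1.

Definition Qc (i : nat) : R :=
  \sum_(0 <= h < k - i) \prod_(0 <= m < h.+1) p (i + m)%N + 1.

(* p extended to the indices k + 1, ..., 2k by p_i = p_(i - k). *)
Definition pcyc (i : nat) : R := if (i <= k)%N then p i else p (i - k)%N.

Definition alpha (j : nat) : R :=
  (\sum_(0 <= h < k.-1) \prod_(0 <= m < h.+1) pcyc (j + m)%N + 1) /
  (\prod_(1 <= m < k.+1) p m - 1).

(* A_(k-j) and L_(k-j) with i = k - j; for i = k the products over
   0 <= h < k - i and i <= m < k are empty. *)
Definition Ac (i : nat) : R :=
  (Pc i)^-1 * C i *
  \prod_(0 <= h < k - i)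
    ((Pc (k - h)%N)^-1 * C (k - h)%N) `^ (\prod_(i <= l < k - h) p l).

Definition Lc (i : nat) : R := lam * \prod_(i <= m < k) p m.

(* L_1 times the constant Ctilde; unlike Ctilde it makes sense for lam = 0. *)
Definition LCtilde : R :=
  (Pc 1 - Qc 1 - 1) * 2 `^ (- (p 1%N * (Pc 2 - 1) / Qc 1)) *
  Pc 1 `^ (Qc 1)^-1 * Ac 1 `^ (Qc 1)^-1.

Definition Ctilde : R := (Lc 1)^-1 * LCtilde.

(* If lam = 0 then L_1 = 0 and Ctilde is infinite. The next three quantities
   are then the limits, as lam tends to 0 from the right, of the expressions
   for lam > 0. They are spelled out because the inverse of 0 is 0 here. *)

Definition f2_threshold : R :=
  if lam == 0 then 0 else
  Ctilde `^ (- alpha 2) * Ac 2 `^ (alpha 2 / (alpha 1 * Pc 2)) *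
  C 1%N `^ (- (alpha 2 * Qc 2 / (alpha 1 * Pc 2))).

(* The argument b stands for f_2(0). *)
Definition T0 (b : R) : R :=
  if lam == 0 then
    Qc 1 * (LCtilde^-1 * Ac 2 `^ (1 / (alpha 1 * Pc 2)) *
            C 1%N `^ (- (Qc 2 / (alpha 1 * Pc 2))) * b `^ (- (1 / alpha 2)))
  else
    - (Lc 1)^-1 * Qc 1 *
    ln (1 - Ctilde^-1 * Ac 2 `^ (1 / (alpha 1 * Pc 2)) *
            C 1%N `^ (- (Qc 2 / (alpha 1 * Pc 2))) * b `^ (- (1 / alpha 2))).

(* Ctilde carries the exponent - alpha_1, as the difference of exponentials
   does: both come from inverting
   (f_1 + a)^(-1/alpha_1) <= Ctilde * (difference of exponentials),
   where a is the subtracted constant. With this exponent the bound vanishes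
   at t = 0; with - 1/alpha_1 it could be positive there although f_1(0) = 0
   is allowed. *)
Definition f1_lower_bound (b t : R) : R :=
  (if lam == 0 then
     LCtilde `^ (- alpha 1) * ((T0 b - t) / Qc 1) `^ (- alpha 1)
   else
     Ctilde `^ (- alpha 1) *
     (expR (- (Lc 1 * t / Qc 1)) - expR (- (Lc 1 * T0 b / Qc 1)))
       `^ (- alpha 1))
  - Ac 2 `^ (- (1 / Pc 2)) * C 1%N `^ (Qc 2 / Pc 2) * b `^ (Qc 1 / Pc 2).

End Constants.

Section System.
Context {R : realType}.

(* Derivative of g at t relative to D: one-sided at an endpoint of D. *)
Definition has_derivative_within (D : set R) (g : R -> R) (t d : R) : Prop :=
  (g s - g t) / (s - t) @[s --> within D t^'] --> d.

(* Since x `^ a >= 0 for every x, each component of a solution is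
   nondecreasing. With nonnegative initial values the powers are therefore
   only taken of nonnegative numbers. *)
Definition solves_inequalities (k : nat) (p C : nat -> R) (lam : R)
    (T : \bar R) (f : nat -> R -> R) : Prop :=
  forall j : nat, (1 <= j <= k)%N ->
  forall t : R, 0 <= t -> (t%:E < T)%E ->
  exists2 d : R,
    has_derivative_within [set s | 0 <= s /\ (s%:E < T)%E] (f j) t d &
    (if (j < k)%N then C j * f j.+1 t `^ p j
     else C k * expR (- lam * t) * f 1%N t `^ p k) <= d.

End System.

(* Main.v *)
Require Import Defs.
From mathcomp Require Import all_boot all_order all_algebra.
From mathcomp Require Import all_classical all_reals all_analysis.
From mathcomp Require Import unstable ring lra zify.
Import Order.TTheory GRing.Theory Num.Theory.
Import numFieldNormedType.Exports.
Local Open Scope ring_scope.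

(** Write P_j, Q_j, A_j, L_j for the constants of the statement and
b = f_2(0). Every component is nondecreasing, so all f_j are nonnegative and
f_2 >= b > 0. The right-hand side g = C_1 f_2^(p_1) of the first inequality is
then positive and nondecreasing, and its primitive F from 0 satisfies F <= f_1
because f_1' >= g and f_1(0) >= 0. Replacing f_1 by F in the last inequality
only weakens it, and turns the first inequality into the equation F' = g; this
is what makes g usable as a multiplier.

The chain of multipliers ([multiplier_chain]): multiply the inequality for f_j
by g^(Q_j). As g is nondecreasing, f_j' g^(Q_j) <= (f_j g^(Q_j))', and by
descending induction on j, starting at k, the other side contains the factor
F^(P_j - 1) F', which integrates to F^(P_j) / P_j. The weight exp(- L_j s) is
decreasing in s, so it may be frozen at its final value. This gives
  f_j(t) g(t)^(Q_j)
    >= f_j(0) g(0)^(Q_j) + A_j exp(- L_j t) F(t)^(P_j)      for 2 <= j <= k,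
and the recursions P_j = p_j P_(j+1) + 1, Q_j = p_j Q_(j+1) + 1,
L_j = p_j L_(j+1), A_j = P_j^(-1) C_j A_(j+1)^(p_j) are what one step does to
the parameters.

For j = 2 the initial term is A_2 a^(P_2), where a is the constant subtracted
in the lower bound for f_1. Convexity of the P_2-th power replaces
F^(P_2) + a^(P_2) by 2^(1 - P_2) (F + a)^(P_2), and since g^(Q_1) equals
C_1 (f_2 g^(Q_2))^(p_1) one gets the scalar inequality
  (F + a)' = g >= kappa exp(- L_1 t / Q_1) (F + a)^(1 + 1/alpha_1)
([first_component_speed]). Integrating it bounds (F + a)^(-1/alpha_1) above
by an affine function of the primitive of exp(- L_1 t / Q_1)
([inverse_power_decay]), which is Ctilde times the difference of
exponentials in the statement when lambda > 0 and a multiple of T_0 - t when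
lambda = 0. This quantity has to stay positive, whence t < T_0, and inverting
the power gives the lower bound. When lambda > 0, the threshold on b says
exactly that the logarithm in T_0 has a positive argument. *)

Set Implicit Arguments.
Unset Strict Implicit.
Unset Printing Implicit Defensive.

(** * Calculus on an interval *)

Section Calculus.
Context {R : realType}.
Local Open Scope classical_set_scope.
Implicit Types (f g h u F : R -> R) (D : set R).
Implicit Types (a b d r t x y B L Q m : R).

Lemma within_derivative_continuous D g x d : D x ->
  has_derivative_within D g x d -> g s @[s --> within D (nbhs x)] --> g x.
Proof.
move=> Dx dg; apply/cvgrPdist_lt => e e0.
have : (g s - g x) / (s - x) * (s - x) @[s --> within D x^'] --> d * (x - x).
  apply: cvgM => //; apply: cvgB; last exact: cvg_cst.
  apply: cvg_trans; last exact: cvg_id.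
  by move=> P; rewrite /within/= /dnbhs => PP; apply: filterS PP => y + ? ?; apply.
rewrite subrr mulr0 => /cvgrPdist_lt/(_ e e0).
rewrite !near_withinE /=; apply: filterS => y + Dy.
have [->|yx] := eqVneq y x; first by rewrite subrr normr0.
move=> /(_ isT Dy).
by rewrite divfK ?subr_eq0// sub0r opprB.
Qed.

Lemma within_derivative_interior D g x d : nbhs x D ->
  has_derivative_within D g x d -> is_derive x 1 g d.
Proof.
move=> Dx dg.
suff H : h^-1 *: (g (h *: 1 + x) - g x) @[h --> 0^'] --> d.
  by split; [apply/cvg_ex; exists d| apply/cvg_lim].
apply/cvgrPdist_lt => e e0.
move/cvgrPdist_lt : dg => /(_ e e0).
rewrite !near_withinE => H.
have {}H : \forall y \near x, y != x -> `|d - (g y - g x) / (y - x)| < e.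
  near=> y => yx.
  have Dy : D y by near: y.
  by move: yx Dy; near: y.
have : \forall h \near (0 : R),
    h + x != x -> `|d - (g (h + x) - g x) / (h + x - x)| < e.
  have c : h + x @[h --> (0:R)] --> x.
    by rewrite -[X in _ --> X]add0r; apply: cvgD; [exact: cvg_id|exact: cvg_cst].
  exact: (c _ H).
apply: filterS => h + h0.
rewrite addrK -subr_eq0 addrK h0 => /(_ isT).
by rewrite /GRing.scale/= mulr1 mulrC.
Unshelve. all: by end_near. Qed.

Lemma nonneg_derivative_le h a b : a <= b ->
  (forall x, a < x < b -> exists2 d, is_derive x 1 h d & 0 <= d) ->
  {within `[a, b], continuous h} -> h a <= h b.
Proof.
move=> ab dh ch.
have dh' x : x \in `]a, b[%R -> derivable h x 1 /\ 0 <= h^`() x.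
  rewrite in_itv/= => /dh[d hd d0]; split; first exact: ex_derive.
  by rewrite derive1E derive_val.
by apply: (@ger0_derive1_ndecr _ h a b) => // x /dh'[].
Qed.

Lemma is_derive1_powRr h x d r : 0 < h x -> is_derive x 1 h d ->
  is_derive x 1 (fun y => h y `^ r) (r * h x `^ (r - 1) * d).
Proof.
move=> h0 hd.
exact: (@is_derive1_comp R (@powR R ^~ r) h x _ _ (@is_derive1_powR R r _ h0) hd).
Qed.

(** A real power takes the value 1 at negative arguments, hence is discontinuous
at 0; composing with the norm repairs this without changing the values at
nonnegative arguments. *)
Lemma continuous_normr_powR r : 0 < r -> continuous (fun x : R => `|x| `^ r).
Proof.
move=> r0 x; have [->|x0] := eqVneq x 0.
  apply/cvgrPdist_lt => e e0.
  rewrite normr0 powR0 ?gt_eqF//.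
  near=> y.
  rewrite sub0r normrN ger0_norm ?powR_ge0//.
  have -> : e = (e `^ r^-1) `^ r by rewrite -powRrM mulVf ?gt_eqF// powRr1// ltW.
  apply: gt0_ltr_powR => //; rewrite ?nnegrE// ?powR_ge0//.
  have : `|0 - y| < e `^ r^-1.
    near: y; apply: cvgr_dist_lt; rewrite ?powR_gt0//.
  by rewrite sub0r normrN.
have cp : {for `|x|, continuous (@powR R ^~ r)}.
  apply/differentiable_continuous; rewrite -derivable1_diffP.
  by apply: derivable_powR; rewrite in_itv/= andbT normr_gt0.
exact: (cvg_comp _ _ (@norm_continuous _ R x) cp).
Unshelve. all: by end_near. Qed.

Lemma within_continuous_powR D h r : (forall x, D x -> 0 <= h x) -> 0 <= r ->
  {within D, continuous h} -> {within D, continuous (fun x => h x `^ r)}.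
Proof.
move=> h0; rewrite le_eqVlt => /predU1P[<- _|r0 ch].
  under eq_fun do rewrite powRr0.
  by apply: continuous_subspaceT => x; exact: cvg_cst.
apply: (@subspace_eq_continuous _ _ _ (fun x => `|h x| `^ r)).
  by move=> x /set_mem Dx; rewrite ger0_norm// h0.
move=> x.
apply: (@continuous_comp _ _ _ (h : subspace D -> R) (fun y => `|y| `^ r)).
  exact: ch.
exact: continuous_normr_powR.
Qed.

Lemma within_continuous_powR_pos D h r : (forall x, D x -> 0 < h x) ->
  {within D, continuous h} -> {within D, continuous (fun x => h x `^ r)}.
Proof.
move=> h0 /subspace_continuousP ch; apply/subspace_continuousP => x Dx.
have cp : {for h x, continuous (@powR R ^~ r)}.
  apply/differentiable_continuous; rewrite -derivable1_diffP.
  by apply: derivable_powR; rewrite in_itv/= andbT h0.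
exact: (cvg_comp _ _ (ch x Dx) cp).
Qed.

Lemma within_continuousM D f g : {within D, continuous f} ->
  {within D, continuous g} -> {within D, continuous (fun x => f x * g x)}.
Proof. by move=> cf cg x; apply: cvgM; [exact: cf|exact: cg]. Qed.

Lemma within_continuousB D f g : {within D, continuous f} ->
  {within D, continuous g} -> {within D, continuous (fun x => f x - g x)}.
Proof. by move=> cf cg x; apply: cvgB; [exact: cf|exact: cg]. Qed.

Lemma continuous_primitive g t : 0 < t -> {within `[0, t], continuous g} ->
  exists F, [/\ F 0 = 0, {within `[0, t], continuous F} &
    forall x, 0 < x < t -> is_derive x 1 F (g x)].
Proof.
move=> t0 cg.
have ig : (@lebesgue_measure R).-integrable `[0, t] (EFin \o g).
  by apply: continuous_compact_integrable => //; exact: segment_compact.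
exists (fun x => parameterized_integral lebesgue_measure 0 x g); split.
- by rewrite /parameterized_integral set_itv1 Rintegral_set1.
- exact: parameterized_integral_continuous (ltW t0) ig.
- move=> x /andP[x0 xt].
  have cx : {for x, continuous g}.
    by apply: (within_continuous_continuous t0 cg); rewrite in_itv/= x0 xt.
  have [dF FE] := continuous_FTC1_closed xt ig x0 cx.
  by split; [exact: dF|rewrite -derive1E].
Qed.

Lemma expR_primitive L Q x : L != 0 -> Q != 0 ->
  is_derive x 1 (fun s => Q / L * (1 - expR (- (L * s / Q))))
    (expR (- (L * x / Q))).
Proof.
move=> L0 Q0.
have -> : (fun s => Q / L * (1 - expR (- (L * s / Q)))) =
    (fun s => Q / L * (1 - expR (- (L / Q) * s))).
  by apply/funext => s; congr (_ * (_ - expR _)); rewrite mulNr mulrAC.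
have lin := is_deriveZ (- (L / Q)) (is_derive_id x (1 : R)).
have ex := is_derive1_comp (is_derive_expR _) lin.
have := is_deriveZ (Q / L) (is_deriveB (is_derive_cst (1 : R) x 1) ex).
move/trigger_derive; apply; rewrite /GRing.scale/=.
have -> : - (L * x / Q) = - (L / Q) * x by rewrite mulNr mulrAC.
by field; rewrite ?L0 ?Q0.
Qed.

(** Convexity of the r-th power at the midpoint. *)
Lemma powR_mean_le r x y : 1 <= r -> 0 <= x -> 0 <= y ->
  2 `^ (- (r - 1)) * (x + y) `^ r <= x `^ r + y `^ r.
Proof.
move=> r1 x0 y0.
have half01 : 0 <= 2^-1 :> R /\ 2^-1 <= 1 :> R by split; lra.
have := convex_powR r1 (Itv01 half01.1 half01.2).
move=> /(_ x y); rewrite !inE/= !in_itv/= !andbT => /(_ x0 y0).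
rewrite !convRE/= /onem => H.
have -> : 2 `^ (- (r - 1)) * (x + y) `^ r = 2 * (2^-1 * x + (1 - 2^-1) * y) `^ r.
  have -> : 2^-1 * x + (1 - 2^-1) * y = 2^-1 * (x + y) by lra.
  rewrite powRM ?invr_ge0 ?addr_ge0// opprB powRB ?pnatr_eq0 ?implybT//.
  by rewrite powRr1// -[in RHS](powR_inv1 (a := 2))// -powRrM mulN1r powRN mulrA.
rewrite -ler_pdivlMl//; apply: (le_trans H); lra.
Qed.

(** One link of the chain: from u' g^r >= B exp(- L s) F^m and F' = g, the
product u g^(r+1) grows at least like B/(m+1) exp(- L x) F^(m+1). The term with
g' is dropped because g is nondecreasing. *)
Lemma weighted_integration u g F t B L r m :
  0 <= L -> 0 <= B -> 0 <= r -> 0 <= m ->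
  {within `[0, t], continuous u} -> {within `[0, t], continuous g} ->
  {within `[0, t], continuous F} ->
  (forall x, 0 <= x <= t -> 0 <= u x) -> (forall x, 0 <= x <= t -> 0 < g x) ->
  F 0 = 0 -> (forall x, 0 < x <= t -> 0 < F x) ->
  (forall x, 0 < x < t -> is_derive x 1 F (g x)) ->
  (forall x, 0 < x < t -> exists2 d, is_derive x 1 g d & 0 <= d) ->
  (forall x, 0 < x < t -> exists2 d, is_derive x 1 u d &
     B * expR (- (L * x)) * F x `^ m <= d * g x `^ r) ->
  forall x, 0 <= x <= t ->
    u 0 * g 0 `^ (r + 1) + B / (m + 1) * expR (- (L * x)) * F x `^ (m + 1)
    <= u x * g x `^ (r + 1).
Proof.
move=> L0 B0 r0 m0 cu cg cF u0 g0 F0 Fgt0 dF dg du x /andP[x0 xt].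
(* The weight is frozen at x, where it is smallest on [0, x]. *)
pose K := B / (m + 1) * expR (- (L * x)).
pose h s := u s * g s `^ (r + 1) - K * F s `^ (m + 1).
have m1 : 0 < m + 1 by lra.
have sub : `[0, x] `<=` `[0, t].
  by move=> s /=; rewrite !in_itv/= => /andP[-> sx]; exact: le_trans xt.
have Fge0 s : 0 <= s <= t -> 0 <= F s.
  move=> /andP[]; rewrite le_eqVlt => /predU1P[<- _|s0 st]; first by rewrite F0.
  by rewrite ltW// Fgt0// s0.
suff : h 0 <= h x.
  rewrite /h F0 powR0 ?gt_eqF// mulr0 subr0 -/K; lra.
apply: nonneg_derivative_le => //.
- move=> s /andP[s0 sx]; have st : s < t by exact: lt_le_trans xt.
  have I : 0 < s < t by rewrite s0 st.
  have I' : 0 <= s <= t by rewrite !ltW.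
  have F1 : 0 < F s by rewrite Fgt0// s0 ltW.
  have [du' hu H] := du s I; have [dg' hg dg0] := dg s I.
  have dgr := is_derive1_powRr (r + 1) (g0 s I') hg.
  have dFm := is_derive1_powRr (m + 1) F1 (dF s I).
  exists (u s * ((r + 1) * g s `^ (r + 1 - 1) * dg') + g s `^ (r + 1) * du'
          - K * ((m + 1) * F s `^ (m + 1 - 1) * g s)).
    exact: (is_deriveB (is_deriveM hu dgr) (is_deriveZ K dFm)).
  rewrite !addrK.
  have gr : g s `^ (r + 1) = g s `^ r * g s.
    by rewrite powRD ?(gt_eqF (g0 s I')) ?implybT// powRr1// ltW// g0.
  have -> : u s * ((r + 1) * g s `^ r * dg') + g s `^ (r + 1) * du' -
      K * ((m + 1) * F s `^ m * g s) =
      u s * ((r + 1) * g s `^ r * dg') +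
      g s * (du' * g s `^ r - B * expR (- (L * x)) * F s `^ m).
    by rewrite gr /K; field; rewrite gt_eqF.
  have H1 : B * expR (- (L * x)) * F s `^ m <= B * expR (- (L * s)) * F s `^ m.
    by rewrite ler_wpM2r ?powR_ge0// ler_wpM2l// ler_expR lerN2 ler_wpM2l// ltW.
  rewrite addr_ge0// ?mulr_ge0 ?powR_ge0 ?u0//; first lra.
    exact/ltW/g0.
  lra.
- apply: within_continuousB; apply: within_continuousM.
  + exact: continuous_subspaceW cu.
  + apply: within_continuous_powR_pos; last exact: continuous_subspaceW cg.
    by move=> s /sub/=; rewrite in_itv/=; exact: g0.
  + by apply: continuous_subspaceT => ?; exact: cvg_cst.
  + apply: (@continuous_subspaceW _ _ _ `[0, t]) => //.
    by apply: within_continuous_powR => //; lra.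
Qed.

(** A solution of y' >= kap e y^(1+s), divided by y^(1+s): the derivative of
y^(-s) is at most - s kap e, and E is a primitive of e. *)
Lemma power_comparison (y g e E : R -> R) (t kap s : R) : 0 <= t -> 0 < s ->
  {within `[0, t], continuous y} -> {within `[0, t], continuous E} ->
  (forall x, 0 <= x <= t -> 0 < y x) ->
  (forall x, 0 < x < t -> is_derive x 1 y (g x)) ->
  (forall x, 0 < x < t -> is_derive x 1 E (e x)) ->
  (forall x, 0 < x < t -> kap * e x * y x `^ (1 + s) <= g x) ->
  y t `^ (- s) + s * kap * E t <= y 0 `^ (- s) + s * kap * E 0.
Proof.
move=> t0 s0 cy cE y0 dy dE H.
pose h x := - s * kap * E x - y x `^ (- s).
suff : h 0 <= h t by rewrite /h; lra.
apply: nonneg_derivative_le => //.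
- move=> x I; have I' : 0 <= x <= t by case/andP: I => *; rewrite !ltW.
  exists (- s * kap * e x - (- s * y x `^ (- s - 1) * g x)).
    exact: (is_deriveB (is_deriveZ (- s * kap) (dE x I))
                       (is_derive1_powRr (- s) (y0 x I') (dy x I))).
  have -> : - s * kap * e x - - s * y x `^ (- s - 1) * g x =
            s * y x `^ (- s - 1) * (g x - kap * e x * y x `^ (1 + s)).
    have : y x `^ (- s - 1) * y x `^ (1 + s) = 1.
      rewrite -powRD ?(gt_eqF (y0 x I')) ?implybT//.
      by rewrite (_ : _ + _ = 0) ?powRr0//; ring.
    move: (_ `^ (- s - 1)) (_ `^ (1 + s)) => z w zw.
    have -> : s * z * (g x - kap * e x * w) =
              s * z * g x - s * kap * e x * (z * w) by ring.
    rewrite zw; ring.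
  by rewrite mulr_ge0 ?subr_ge0 ?H// mulr_ge0 ?powR_ge0// ltW.
- apply: within_continuousB; last first.
    exact: within_continuous_powR_pos.
  apply: within_continuousM => //.
  by apply: continuous_subspaceT => ?; exact: cvg_cst.
Qed.

End Calculus.

(** * Algebra of real powers *)

Section PowerAlgebra.
Context {R : realType}.
Implicit Types (a A C P Q p b v F e y z s g l c al : R).

Lemma powRM3 (x y z r : R) : 0 <= x -> 0 <= y -> 0 <= z ->
  (x * y * z) `^ r = x `^ r * y `^ r * z `^ r.
Proof. by move=> x0 y0 z0; rewrite !powRM ?mulr_ge0. Qed.

(** The passage from the estimate for the second component (hypothesis on
v = f_2(x), with F = F(x), e = exp(- L_2 x)) to a bound on a power of g. The
shift a is chosen so that A a^P is the initial term b g(0)^Q, and e <= 1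
allows both terms to carry the weight e. *)
Lemma speed_bound_algebra A C P Q p b v F e g a :
  0 < A -> 0 < C -> 1 <= P -> 0 <= Q -> 0 <= p -> 0 < b -> 0 < v -> 0 <= F ->
  0 < e -> e <= 1 ->
  g = C * v `^ p ->
  a = A `^ (- (1 / P)) * C `^ (Q / P) * b `^ ((p * Q + 1) / P) ->
  b * (C * b `^ p) `^ Q + A * e * F `^ P <= v * g `^ Q ->
  C * A `^ p * 2 `^ (- (p * (P - 1))) * e `^ p * (F + a) `^ (p * P)
  <= g `^ (p * Q + 1).
Proof.
move=> A0 C0 P1 Q0 p0 b0 v0 F0 e0 e1 gE aE H.
have P0 : P != 0 by rewrite gt_eqF// (lt_le_trans ltr01).
have a0 : 0 < a by rewrite aE !mulr_gt0 ?powR_gt0.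
have g0 : 0 < g by rewrite gE mulr_gt0 ?powR_gt0.
have aP : A * a `^ P = b * (C * b `^ p) `^ Q.
  rewrite aE powRM3 ?powR_ge0// -!powRrM !mulrA.
  rewrite mulNr !divfK// powR_inv1 ?ltW// divff ?gt_eqF// mul1r.
  rewrite powRM ?powR_ge0 ?(ltW C0)//.
  rewrite powRD ?(gt_eqF b0) ?implybT// (powRr1 (ltW b0)) powRrM; ring.
have base : A * e * (2 `^ (- (P - 1)) * (F + a) `^ P) <= v * g `^ Q.
  apply: le_trans H; rewrite -aP.
  apply: (@le_trans _ _ (A * e * (F `^ P + a `^ P))).
    by rewrite (ler_wpM2l (mulr_ge0 (ltW A0) (ltW e0)))// powR_mean_le// ltW.
  rewrite mulrDr addrC lerD2r -mulrA (ler_wpM2l (ltW A0))//.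
  by rewrite ler_piMl// powR_ge0.
have base0 : 0 <= A * e * (2 `^ (- (P - 1)) * (F + a) `^ P).
  by rewrite !mulr_ge0 ?powR_ge0 ?ltW.
have gQ0 : 0 <= v * g `^ Q by rewrite mulr_ge0 ?powR_ge0 ?ltW.
have := ler_wpM2l (ltW C0) (ge0_ler_powR p0 base0 gQ0 base).
have -> : C * (v * g `^ Q) `^ p = g `^ (p * Q + 1).
  rewrite (powRM _ (ltW v0) (powR_ge0 g Q)) [LHS]mulrA -gE (mulrC p Q).
  by rewrite powRD ?(gt_eqF g0) ?implybT// (powRr1 (ltW g0)) powRrM mulrC.
have -> : 2 `^ (- (p * (P - 1))) = (2 `^ (- (P - 1))) `^ p :> R.
  by rewrite -powRrM mulNr mulrC.
have -> : (F + a) `^ (p * P) = ((F + a) `^ P) `^ p by rewrite mulrC powRrM.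
have P0' := powR_ge0 (F + a) P; have t0 := powR_ge0 (2 : R) (- (P - 1)).
rewrite (powRM _ (mulr_ge0 (ltW A0) (ltW e0)) (mulr_ge0 t0 P0')).
rewrite (powRM _ (ltW A0) (ltW e0)) (powRM _ t0 P0').
by rewrite !mulrA (mulrAC _ (e `^ p)).
Qed.

Lemma root_bound A P Q c l y s g : 0 < A -> 0 < P -> 0 < Q -> 0 < y -> 0 <= g ->
  (1 + s) * Q = P - 1 ->
  P * A * 2 `^ (- c) * expR (- l) * y `^ (P - 1) <= g `^ Q ->
  2 `^ (- (c / Q)) * P `^ Q^-1 * A `^ Q^-1 * expR (- (l / Q)) * y `^ (1 + s) <= g.
Proof.
move=> A0 P0 Q0 y0 g0 sQ H; set z := (X in X <= g).
have t0 := powR_ge0 (2 : R) (- (c / Q)).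
have rP := powR_ge0 P Q^-1; have rA := powR_ge0 A Q^-1.
have e0 := expR_ge0 (- (l / Q)); have ry := powR_ge0 y (1 + s).
have z0 : 0 <= z by rewrite /z !mulr_ge0.
have zQ : z `^ Q = P * A * 2 `^ (- c) * expR (- l) * y `^ (P - 1).
  have Qn0 : Q != 0 by rewrite gt_eqF.
  have rootK x : 0 <= x -> (x `^ Q^-1) `^ Q = x.
    by move=> x0; rewrite -powRrM mulVf// powRr1.
  rewrite /z (powRM _ (mulr_ge0 (mulr_ge0 (mulr_ge0 t0 rP) rA) e0) ry).
  rewrite (powRM _ (mulr_ge0 (mulr_ge0 t0 rP) rA) e0).
  rewrite (powRM _ (mulr_ge0 t0 rP) rA) (powRM _ t0 rP).
  rewrite (rootK _ (ltW P0)) (rootK _ (ltW A0)).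
  rewrite -expRM -[(y `^ _) `^ _]powRrM sQ -[(2 `^ _) `^ _]powRrM.
  by rewrite !mulNr !divfK// -(mulrA (2 `^ (- c))) (mulrC (2 `^ (- c))).
rewrite leNgt; apply/negP => /(gt0_ltr_powR Q0 g0 z0).
by rewrite zQ ltNge H.
Qed.

Lemma inverse_power_bound y al z : 0 < al -> 0 < y ->
  y `^ (- (1 / al)) <= z -> z `^ (- al) <= y.
Proof.
move=> al0 y0 H; have yp := powR_gt0 (- (1 / al)) y0.
have z0 : 0 < z by exact: lt_le_trans H.
have -> : y = (y `^ (- (1 / al))) `^ (- al).
  by rewrite -powRrM mulrNN div1r mulVf ?gt_eqF// powRr1// ltW.
rewrite powRN [leRHS]powRN lef_pV2 ?posrE ?powR_gt0//.
by apply: ge0_ler_powR => //; rewrite ?nnegrE ltW.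
Qed.

Lemma threshold_lt1 (c X b al : R) : 0 < c -> 0 < X -> 0 < b -> 0 < al ->
  c `^ (- al) * X `^ al < b -> c^-1 * X * b `^ (- (1 / al)) < 1.
Proof.
move=> c0 X0 b0 al0 H.
have ba : b = (b `^ (1 / al)) `^ al.
  by rewrite -powRrM div1r mulVf ?gt_eqF// powRr1// ltW.
have bp : 0 < b `^ (1 / al) by exact: powR_gt0.
rewrite powRN ltr_pdivrMr// [ltRHS]mul1r ltNge; apply/negP => le_b.
have cX0 : 0 <= c^-1 * X by rewrite mulr_ge0// ?invr_ge0 ltW.
have := ge0_ler_powR (ltW al0) (ltW bp) cX0 le_b.
rewrite -ba powRM ?invr_ge0 ?(ltW c0) ?(ltW X0)//.
have -> : c^-1 `^ al = c `^ (- al) by rewrite -(powR_inv1 (ltW c0)) -powRrM mulN1r.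
by rewrite leNgt H.
Qed.

End PowerAlgebra.

(** * The constants *)

Section Constants.
Context {R : realType}.
Variables (k : nat) (p C : nat -> R) (lam : R).

Let psum n i : R := \sum_(0 <= h < n) \prod_(0 <= m < h.+1) p (i + m)%N.

Let psum_recl n i : psum n.+1 i = p i * (psum n i.+1 + 1).
Proof.
rewrite /psum big_nat_recl// mulrDr mulr1 addrC; congr (_ + _); last first.
  by rewrite big_nat1 addn0.
rewrite big_distrr/=; apply: eq_bigr => h _; rewrite big_nat_recl// addn0.
by congr (_ * _); apply: eq_bigr => m _; rewrite addSnnS.
Qed.

Let psum_recr n i :
  psum n.+1 i = psum n i + \prod_(0 <= m < n.+1) p (i + m)%N.
Proof. by rewrite /psum big_nat_recr. Qed.

Lemma Pc_last : Pc k p k = p k + 1.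
Proof. by rewrite /Pc subnn big_nat1 big_nat1 addn0. Qed.

Lemma Pc_rec i : (i < k)%N -> Pc k p i = p i * Pc k p i.+1 + 1.
Proof. by move=> ik; rewrite /Pc -!/(psum _ _) psum_recl subnSK. Qed.

Lemma Qc_last : Qc k p k = 1.
Proof. by rewrite /Qc subnn big_geq// add0r. Qed.

Lemma Qc_rec i : (i < k)%N -> Qc k p i = p i * Qc k p i.+1 + 1.
Proof.
by move=> ik; rewrite /Qc -!/(psum _ _) -(subnSK ik) psum_recl.
Qed.

Lemma Lc_last : Lc k p lam k = lam.
Proof. by rewrite /Lc big_geq// mulr1. Qed.

Lemma Lc_rec i : (i < k)%N -> Lc k p lam i = p i * Lc k p lam i.+1.
Proof. by move=> ik; rewrite /Lc big_ltn// mulrCA. Qed.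

(** The sums defining P_1 and Q_1 differ by their longest product only. *)
Lemma PcB_Qc : (0 < k)%N ->
  Pc k p 1 - Qc k p 1 - 1 = \prod_(1 <= m < k.+1) p m - 1.
Proof.
move=> k0; rewrite /Pc /Qc -!/(psum _ _) psum_recr.
rewrite big_add1/= subn1 prednK//; under [in RHS]eq_bigr do rewrite -add1n.
ring.
Qed.

Lemma alpha1E : (2 <= k)%N ->
  alpha k p 1 = Qc k p 1 / (Pc k p 1 - Qc k p 1 - 1).
Proof.
move=> k2; rewrite PcB_Qc; last exact: ltnW.
rewrite /alpha /Qc subn1; congr ((_ + 1) / _).
apply: eq_big_nat => h /andP[_ hk]; apply: eq_big_nat => m /andP[_ mh].
by rewrite /pcyc ifT//; lia.
Qed.

Lemma alpha2E : (2 <= k)%N ->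
  alpha k p 2 = Pc k p 2 / (Pc k p 1 - Qc k p 1 - 1).
Proof.
move=> k2; rewrite PcB_Qc; last exact: ltnW.
rewrite /alpha /Pc; congr ((_ + 1) / _).
have -> : (k - 2).+1 = k.-1 by lia.
apply: eq_big_nat => h /andP[_ hk]; apply: eq_big_nat => m /andP[_ mh].
by rewrite /pcyc ifT//; lia.
Qed.

Hypothesis hp : forall j : nat, (1 <= j <= k)%N -> 1 <= p j.
Hypothesis hC : forall j : nat, (1 <= j <= k)%N -> 0 < C j.

Let psum_ge0 n i : (1 <= i)%N -> (i + n <= k.+1)%N -> 0 <= psum n i.
Proof.
move=> i1 ink; rewrite /psum big_nat; apply: sumr_ge0 => h hn.
rewrite big_nat; apply: prodr_ge0 => m mh.
by apply: le_trans (hp _) => //; lia.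
Qed.

Lemma Qc_ge1 i : (1 <= i <= k)%N -> 1 <= Qc k p i.
Proof. by move=> ik; rewrite /Qc lerDr psum_ge0//; lia. Qed.

Lemma Pc_ge1 i : (1 <= i <= k)%N -> 1 <= Pc k p i.
Proof. by move=> ik; rewrite /Pc lerDr psum_ge0//; lia. Qed.

Lemma Lc_ge0 i : 0 <= lam -> (1 <= i)%N -> 0 <= Lc k p lam i.
Proof.
move=> hlam i1; rewrite /Lc mulr_ge0// big_nat prodr_ge0// => m mi.
by apply: le_trans (hp _) => //; lia.
Qed.

Lemma Lc_eq0 : (Lc k p lam 1 == 0) = (lam == 0).
Proof.
rewrite /Lc mulf_eq0; have [//|_] /= := eqVneq lam 0.
apply/negbTE; rewrite gt_eqF// big_nat prodr_gt0// => m mi.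
by apply: lt_le_trans (hp _) => //; lia.
Qed.

Let powR_prod n (x : nat -> R) a : (forall h, (h < n)%N -> 0 <= x h) ->
  (\prod_(0 <= h < n) x h) `^ a = \prod_(0 <= h < n) x h `^ a.
Proof.
elim: n => [|n ih] x0; first by rewrite !big_geq// powR1.
rewrite !big_nat_recr//= powRM ?ih// ?x0// => [h hn|].
  by rewrite x0// ltnS ltnW.
by rewrite big_nat prodr_ge0// => h hn; rewrite x0//; lia.
Qed.

Lemma Ac_gt0 i : (1 <= i <= k)%N -> 0 < Ac k p C i.
Proof.
have Xgt0 j : (1 <= j <= k)%N -> 0 < (Pc k p j)^-1 * C j.
  by move=> jk; rewrite mulr_gt0 ?hC// invr_gt0 (lt_le_trans _ (Pc_ge1 jk)).
move=> ik; rewrite mulr_gt0 ?Xgt0// big_nat prodr_gt0// => h hk.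
by rewrite powR_gt0 ?Xgt0//; lia.
Qed.

Lemma Ac_last : Ac k p C k = (Pc k p k)^-1 * C k.
Proof. by rewrite /Ac subnn big_geq// mulr1. Qed.

Lemma Ac_rec i : (1 <= i < k)%N ->
  Ac k p C i = (Pc k p i)^-1 * C i * Ac k p C i.+1 `^ p i.
Proof.
move=> ik; have X0 j : (1 <= j <= k)%N -> 0 <= (Pc k p j)^-1 * C j.
  move=> jk; rewrite ltW// mulr_gt0 ?hC// invr_gt0.
  by rewrite (lt_le_trans _ (Pc_ge1 jk)).
rewrite /Ac; congr (_ * _).
rewrite powRM ?X0//; last 2 first.
- lia.
- by rewrite big_nat prodr_ge0// => h hk; rewrite powR_ge0.
rewrite powR_prod => [|h hk]; last by rewrite powR_ge0.
rewrite -subnSK; last by lia.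
rewrite big_nat_recr//= mulrC; congr (_ * _).
  have -> : (k - (k - i.+1) = i.+1)%N by lia.
  by rewrite big_nat1.
apply: eq_big_nat => h hk; rewrite -powRrM; congr (_ `^ _).
by rewrite big_ltn 1?mulrC//; lia.
Qed.

End Constants.

Lemma prod_gt1 {R : realType} k (p : nat -> R) :
  (forall j : nat, (1 <= j <= k)%N -> 1 <= p j) ->
  (exists2 j : nat, (1 <= j <= k)%N & p j != 1) ->
  1 < \prod_(1 <= m < k.+1) p m.
Proof.
move=> hp [j jk pj].
have pj1 : 1 < p j by rewrite lt_neqAle eq_sym pj hp.
rewrite (@big_cat_nat _ _ _ j)/=; [|lia|lia].
rewrite [X in _ * X]big_ltn; last lia.
have ge1 a b : (1 <= a)%N -> (b <= k.+1)%N -> 1 <= \prod_(a <= m < b) p m.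
  move=> a1 bk; rewrite big_nat; apply: (big_ind (fun x => 1 <= x)) => //.
    exact: mulr_ege1.
  by move=> m mab; apply: hp; lia.
have := ge1 1 j isT; have := ge1 j.+1 k.+1 isT (leqnn _).
move=> y1 /(_ ltac:(lia)) x1.
apply: (lt_le_trans pj1); rewrite mulrCA ler_peMr ?mulr_ege1//; lra.
Qed.

Section BlowUpConstants.
Context {R : realType}.
Variables (k : nat) (p C : nat -> R) (lam : R).
Hypothesis hk : (2 <= k)%N.
Let k11 : (1 <= 1 <= k)%N. Proof. lia. Qed.
Let k22 : (1 <= 2 <= k)%N. Proof. lia. Qed.
Hypothesis hp : forall j : nat, (1 <= j <= k)%N -> 1 <= p j.
Hypothesis hp1 : exists2 j : nat, (1 <= j <= k)%N & p j != 1.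
Hypothesis hC : forall j : nat, (1 <= j <= k)%N -> 0 < C j.
Hypothesis hlam : 0 <= lam.

Let P1_gt0 : 0 < Pc k p 1. Proof. exact: lt_le_trans ltr01 (Pc_ge1 hp k11). Qed.
Let P2_gt0 : 0 < Pc k p 2. Proof. exact: lt_le_trans ltr01 (Pc_ge1 hp k22). Qed.

Lemma Qc1_gt0 : 0 < Qc k p 1.
Proof. exact: lt_le_trans ltr01 (Qc_ge1 hp k11). Qed.

Lemma PcB_Qc_gt0 : 0 < Pc k p 1 - Qc k p 1 - 1.
Proof. by rewrite PcB_Qc ?subr_gt0 ?prod_gt1// ltnW. Qed.

Lemma alpha1_gt0 : 0 < alpha k p 1.
Proof. by rewrite alpha1E// divr_gt0// ?Qc1_gt0// PcB_Qc_gt0. Qed.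

Lemma alpha2_gt0 : 0 < alpha k p 2.
Proof. by rewrite alpha2E// divr_gt0// PcB_Qc_gt0. Qed.

Lemma LCtilde_gt0 : 0 < LCtilde k p C.
Proof.
by rewrite !mulr_gt0 ?powR_gt0 ?(Ac_gt0 hp hC k11)// PcB_Qc_gt0.
Qed.

Lemma Lc1_gt0 : lam != 0 -> 0 < Lc k p lam 1.
Proof. by move=> lam0; rewrite lt0r Lc_eq0// lam0 Lc_ge0. Qed.

Lemma Ctilde_gt0 : lam != 0 -> 0 < Ctilde k p C lam.
Proof. by move=> lam0; rewrite mulr_gt0 ?invr_gt0 ?Lc1_gt0// LCtilde_gt0. Qed.

(** The initial value a^(-1/alpha_1) of (F + a)^(-1/alpha_1), in the form in
which it enters T_0; it uses Q_1 / alpha_1 = P_2 / alpha_2. *)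
Lemma shift_inverse_power (b : R) :
  (Ac k p C 2 `^ (- (1 / Pc k p 2)) * C 1%N `^ (Qc k p 2 / Pc k p 2) *
   b `^ (Qc k p 1 / Pc k p 2)) `^ (- (1 / alpha k p 1)) =
  Ac k p C 2 `^ (1 / (alpha k p 1 * Pc k p 2)) *
  C 1%N `^ (- (Qc k p 2 / (alpha k p 1 * Pc k p 2))) *
  b `^ (- (1 / alpha k p 2)).
Proof.
have al0 : alpha k p 1 != 0 by rewrite gt_eqF// alpha1_gt0.
have P20 : Pc k p 2 != 0 by rewrite gt_eqF.
rewrite powRM3 ?powR_ge0// -!powRrM; congr (_ `^ _ * _ `^ _ * _ `^ _).
- by rewrite mulrNN mulf_div mulr1 [Pc k p 2 * _]mulrC.
- by rewrite mulrN mulf_div mulr1 [Pc k p 2 * _]mulrC.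
- have Q0 : Qc k p 1 != 0 by rewrite gt_eqF// Qc1_gt0.
  rewrite alpha1E// alpha2E// mulrN !div1r !invf_div; congr (- _).
  by rewrite mulrC mulrA divfK.
Qed.

Lemma f2_threshold_lt1 (b : R) : lam != 0 -> 0 < b -> f2_threshold k p C lam < b ->
  (Ctilde k p C lam)^-1 * Ac k p C 2 `^ (1 / (alpha k p 1 * Pc k p 2)) *
  C 1%N `^ (- (Qc k p 2 / (alpha k p 1 * Pc k p 2))) *
  b `^ (- (1 / alpha k p 2)) < 1.
Proof.
move=> lam0 b0; rewrite /f2_threshold (negbTE lam0) => H.
have A20 := Ac_gt0 hp hC k22; have C10 := hC k11.
rewrite -[_^-1 * _ * _]mulrA.
apply: threshold_lt1; rewrite ?alpha2_gt0 ?Ctilde_gt0 ?mulr_gt0 ?powR_gt0//.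
rewrite (powRM _ (powR_ge0 _ _) (powR_ge0 _ _)) -!powRrM mulrA.
have -> (x y : R) : - (x / y) * alpha k p 2 = - (alpha k p 2 * x / y).
  by rewrite mulNr mulrC mulrA.
by rewrite div1r [_^-1 * alpha k p 2]mulrC.
Qed.

End BlowUpConstants.

(** * The chain of multipliers *)

Section Chain.
Context {R : realType}.
Local Open Scope classical_set_scope.
Variables (k : nat) (p C : nat -> R) (lam : R).
Hypothesis hk : (2 <= k)%N.
Hypothesis hp : forall j : nat, (1 <= j <= k)%N -> 1 <= p j.
Hypothesis hC : forall j : nat, (1 <= j <= k)%N -> 0 < C j.
Hypothesis hlam : 0 <= lam.
Notation P := (Pc k p).
Notation Q := (Qc k p).
Notation A := (Ac k p C).
Notation L := (Lc k p lam).

Variables (f : nat -> R -> R) (g F : R -> R) (t : R).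
Hypothesis cf : forall j, (1 <= j <= k)%N -> {within `[0, t], continuous (f j)}.
Hypothesis f_ge0 :
  forall j (x : R), (1 <= j <= k)%N -> 0 <= x <= t -> 0 <= f j x.
Hypothesis df : forall j (x : R), (1 <= j < k)%N -> 0 < x < t ->
  exists2 d : R, is_derive x 1 (f j) d & C j * f j.+1 x `^ p j <= d.
Hypothesis dfk : forall x : R, 0 < x < t ->
  exists2 d : R, is_derive x 1 (f k) d & C k * expR (- lam * x) * F x `^ p k <= d.
Hypothesis cg : {within `[0, t], continuous g}.
Hypothesis g_gt0 : forall x : R, 0 <= x <= t -> 0 < g x.
Hypothesis dg : forall x : R, 0 < x < t -> exists2 d : R, is_derive x 1 g d & 0 <= d.
Hypothesis F0 : F 0 = 0.
Hypothesis cF : {within `[0, t], continuous F}.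
Hypothesis F_gt0 : forall x : R, 0 < x <= t -> 0 < F x.
Hypothesis dF : forall x : R, 0 < x < t -> is_derive x 1 F (g x).

(** Descending induction on j: the estimate for j + 1, without its nonnegative
initial term, is raised to the power p_j and inserted into the inequality for
f_j, to which [weighted_integration] applies with r = p_j Q_(j+1) and
m = p_j P_(j+1). *)
Lemma multiplier_chain j x : (2 <= j <= k)%N -> 0 <= x <= t ->
  f j 0 * g 0 `^ Q j + A j * expR (- (L j * x)) * F x `^ P j
  <= f j x * g x `^ Q j.
Proof.
have [n] := ubnP (k - j); elim: n j x => // n ih j x kjn j2k xt.
have jk : (1 <= j <= k)%N by lia.
have p0 : 0 <= p j by apply: le_trans (hp jk).
have [jeq|jlt] := eqVneq j k.
  (* Here F replaces f_1, and no power of g is used yet: r = 0. *)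
  have H : forall s, 0 < s < t -> exists2 d : R, is_derive s 1 (f k) d &
      C k * expR (- (lam * s)) * F s `^ p k <= d * g s `^ 0.
    move=> s /dfk[d fd H]; exists d => //.
    by rewrite powRr0 mulr1 -mulNr.
  have kk : (1 <= k <= k)%N by lia.
  have := weighted_integration hlam (ltW (hC kk)) (lexx 0)
    (le_trans ler01 (hp kk)) (cf kk) cg cF (fun s => @f_ge0 k s kk) g_gt0 F0 F_gt0
    dF dg H xt.
  by rewrite jeq Lc_last Ac_last Qc_last Pc_last add0r [_^-1 * _]mulrC.
have jltk : (j < k)%N by lia.
have kjn' : (k - j.+1 < n)%N by lia.
have jk1 : (1 <= j < k)%N by lia.
have jk2 : (2 <= j.+1 <= k)%N by lia.
have jk3 : (1 <= j.+1 <= k)%N by lia.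
have P1 := Pc_ge1 hp jk3; have Q1 := Qc_ge1 hp jk3.
have A0 := Ac_gt0 hp hC jk3.
have [Hr Hm HB HL] : [/\ 0 <= p j * Q j.+1, 0 <= p j * P j.+1,
    0 <= C j * A j.+1 `^ p j & 0 <= L j].
  split; try by apply: mulr_ge0 => //; lra.
  - by rewrite mulr_ge0 ?powR_ge0// ltW// hC.
  - by apply: (Lc_ge0 hp hlam); lia.
have H s : 0 < s < t -> exists2 d : R, is_derive s 1 (f j) d &
    C j * A j.+1 `^ p j * expR (- (L j * s)) * F s `^ (p j * P j.+1)
    <= d * g s `^ (p j * Q j.+1).
  move=> st; have st' : 0 <= s <= t by case/andP: st => *; rewrite !ltW.
  have [d fd Hd] := df jk1 st; exists d => //.
  apply: (@le_trans _ _ (C j * f j.+1 s `^ p j * g s `^ (p j * Q j.+1))); last first.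
    by rewrite ler_wpM2r// powR_ge0.
  have G0 := g_gt0 st'; have u0 := f_ge0 jk3 st'.
  have e0 := expR_ge0 (- (L j.+1 * s)); have A0' := ltW A0.
  have F0' := powR_ge0 (F s) (P j.+1); have gQ0 := powR_ge0 (g s) (Q j.+1).
  rewrite (Lc_rec p lam jltk).
  have -> : - (p j * L j.+1 * s) = - (L j.+1 * s) * p j by ring.
  rewrite expRM [p j * Q _]mulrC [p j * P _]mulrC !powRrM.
  have -> : C j * A j.+1 `^ p j * expR (- (L j.+1 * s)) `^ p j *
      (F s `^ P j.+1) `^ p j =
      C j * (A j.+1 * expR (- (L j.+1 * s)) * F s `^ P j.+1) `^ p j.
    by rewrite (powRM3 _ A0' e0 F0') !mulrA.
  rewrite -[leRHS]mulrA -(powRM _ u0 gQ0); apply: (ler_wpM2l (ltW (hC jk))).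
  apply: (ge0_ler_powR p0 (mulr_ge0 (mulr_ge0 A0' e0) F0') (mulr_ge0 u0 gQ0)).
  apply: le_trans (ih _ _ _ jk2 st'); last exact: kjn'.
  rewrite lerDr mulr_ge0 ?powR_ge0// f_ge0// lexx.
  by case/andP: st' => *; apply: le_trans; eassumption.
have := weighted_integration HL HB Hr Hm (cf jk) cg cF
  (fun s => @f_ge0 j s jk) g_gt0 F0 F_gt0 dF dg H xt.
rewrite (Ac_rec hp hC jk1) (Qc_rec p jltk) (Pc_rec p jltk).
by rewrite (mulrC (C j * _)) mulrA.
Qed.
End Chain.

(** * Solutions of the system *)

Section Solution.
Context {R : realType}.
Local Open Scope classical_set_scope.
Variables (k : nat) (p C : nat -> R) (lam : R) (T : \bar R) (f : nat -> R -> R).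
Hypothesis hk : (2 <= k)%N.
Hypothesis hp : forall j : nat, (1 <= j <= k)%N -> 1 <= p j.
Hypothesis hC : forall j : nat, (1 <= j <= k)%N -> 0 < C j.
Hypothesis hlam : 0 <= lam.
Hypothesis hp1 : exists2 j : nat, (1 <= j <= k)%N & p j != 1.
Hypothesis hsol : solves_inequalities k p C lam T f.
Hypothesis hf0 : forall j : nat, (1 <= j <= k)%N -> 0 <= f j 0.
Hypothesis hf2 : 0 < f 2%N 0.

Lemma solution_continuous j t : (1 <= j <= k)%N -> (t%:E < T)%E ->
  {within `[0, t], continuous (f j)}.
Proof.
move=> jk tT.
apply: (@continuous_subspaceW _ _ _ [set s | 0 <= s /\ (s%:E < T)%E]).
  move=> s /=; rewrite in_itv/= => /andP[s0 st]; split => //.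
  by apply: le_lt_trans tT; rewrite lee_fin.
apply/subspace_continuousP => x Dx; have [x0 xT] := Dx.
have [d dfx _] := hsol jk x0 xT.
exact: within_derivative_continuous dfx.
Qed.

Lemma solution_derivative j t x : (1 <= j <= k)%N -> (t%:E < T)%E ->
  0 < x < t -> exists2 d : R, is_derive x 1 (f j) d &
    (if (j < k)%N then C j * f j.+1 x `^ p j
     else C k * expR (- lam * x) * f 1%N x `^ p k) <= d.
Proof.
move=> jk tT /andP[x0 xt].
have xT : (x%:E < T)%E by apply: lt_trans tT; rewrite lte_fin.
have [d dfx H] := hsol jk (ltW x0) xT; exists d => //.
apply: within_derivative_interior dfx.
have : x \in `]0, t[%R by rewrite in_itv/= x0.
move=> /near_in_itvoo; apply: filterS => s; rewrite in_itv/= => /andP[s0 st].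
split; first exact: ltW.
by apply: lt_trans tT; rewrite lte_fin.
Qed.

Lemma solution_nondecreasing j t x : (1 <= j <= k)%N -> (t%:E < T)%E ->
  0 <= x <= t -> f j 0 <= f j x.
Proof.
move=> jk tT /andP[x0 xt].
have xT : (x%:E < T)%E by apply: le_lt_trans tT; rewrite lee_fin.
apply: nonneg_derivative_le => //; last exact: solution_continuous.
move=> s sx; have [d fd H] := solution_derivative jk xT sx.
exists d => //; apply: le_trans H.
have C0 i : (1 <= i <= k)%N -> 0 <= C i by move=> /hC/ltW.
have kk : (1 <= k <= k)%N by lia.
by case: ifP => _; rewrite !mulr_ge0 ?C0 ?powR_ge0 ?expR_ge0.
Qed.

Let k11 : (1 <= 1 <= k)%N. Proof. lia. Qed.
Let k22 : (1 <= 2 <= k)%N. Proof. lia. Qed.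
Let k1k : (1 <= 1 < k)%N. Proof. lia. Qed.
Let kk : (1 <= k <= k)%N. Proof. lia. Qed.
Let kltk : (1 < k)%N. Proof. lia. Qed.

Let P1_gt0 : 0 < Pc k p 1. Proof. exact: lt_le_trans ltr01 (Pc_ge1 hp k11). Qed.
Let Q2_ge0 : 0 <= Qc k p 2. Proof. exact: le_trans ler01 (Qc_ge1 hp k22). Qed.
Let p1_ge0 : 0 <= p 1%N. Proof. exact: le_trans ler01 (hp k11). Qed.

(** The factor of P_1 - Q_1 - 1 in L_1 Ctilde. *)
Let kap := 2 `^ (- (p 1%N * (Pc k p 2 - 1) / Qc k p 1)) *
  Pc k p 1 `^ (Qc k p 1)^-1 * Ac k p C 1 `^ (Qc k p 1)^-1.

Let LCtilde_kap : LCtilde k p C / Qc k p 1 = 1 / alpha k p 1 * kap.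
Proof.
rewrite /LCtilde -(mulrA _ (2 `^ _)) -(mulrA _ (_ * _)) -/kap.
by rewrite alpha1E// div1r invf_div mulrAC.
Qed.

Let speed_exponent : (1 + 1 / alpha k p 1) * Qc k p 1 = Pc k p 1 - 1.
Proof.
rewrite alpha1E// div1r invf_div mulrDl mul1r divfK ?gt_eqF ?Qc1_gt0//; ring.
Qed.

Let a := Ac k p C 2 `^ (- (1 / Pc k p 2)) * C 1%N `^ (Qc k p 2 / Pc k p 2) *
         f 2%N 0 `^ (Qc k p 1 / Pc k p 2).
Let a_gt0 : 0 < a.
Proof. by rewrite !mulr_gt0 ?powR_gt0 ?(Ac_gt0 hp hC)// hC. Qed.

Let g x := C 1%N * f 2%N x `^ p 1%N.

Section UpTo.
Variable t : R.
Hypothesis t0 : 0 < t.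
Hypothesis tT : (t%:E < T)%E.

Let inner x : 0 < x < t -> 0 <= x <= t.
Proof. by case/andP=> *; rewrite !ltW. Qed.
Let innerl x : 0 < x < t -> 0 < x <= t.
Proof. by case/andP=> -> /ltW. Qed.

Let f_ge0 j x : (1 <= j <= k)%N -> 0 <= x <= t -> 0 <= f j x.
Proof.
by move=> jk xt; exact: le_trans (hf0 jk) (solution_nondecreasing jk tT xt).
Qed.

Let f2_gt0 x : 0 <= x <= t -> 0 < f 2%N x.
Proof. by move=> xt; exact: lt_le_trans hf2 (solution_nondecreasing k22 tT xt). Qed.

Let g_gt0 x : 0 <= x <= t -> 0 < g x.
Proof. by move=> xt; rewrite mulr_gt0 ?powR_gt0 ?f2_gt0 ?hC. Qed.

Let g_continuous : {within `[0, t], continuous g}.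
Proof.
apply: within_continuousM; first by apply: continuous_subspaceT => ?; exact: cvg_cst.
apply: within_continuous_powR_pos; last exact: solution_continuous.
by move=> s /=; rewrite in_itv/=; exact: f2_gt0.
Qed.

Let g_derivative_ge0 x : 0 < x < t -> exists2 d : R, is_derive x 1 g d & 0 <= d.
Proof.
move=> xt; have [d fd H] := solution_derivative k22 tT xt.
have d0 : 0 <= d.
  apply: le_trans H; have C20 := ltW (hC k22); have Ck0 := ltW (hC kk).
  by case: ifP => _; rewrite !mulr_ge0 ?powR_ge0 ?expR_ge0.
exists (C 1%N * (p 1%N * f 2%N x `^ (p 1%N - 1) * d)).
  exact: (is_deriveZ (C 1%N) (is_derive1_powRr (p 1%N) (f2_gt0 (inner xt)) fd)).
by rewrite !mulr_ge0 ?powR_ge0// ltW// hC.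
Qed.

(** The primitive of g, which may be strictly below f_1: only a lower bound on
the derivative of f_1 is known. *)
Lemma first_component_minorant : exists F : R -> R,
  [/\ F 0 = 0, {within `[0, t], continuous F},
     forall x, 0 < x < t -> is_derive x 1 F (g x),
     forall x, 0 < x <= t -> 0 < F x &
     forall x, 0 < x <= t -> F x <= f 1%N x].
Proof.
have [F [F0 cF dF]] := continuous_primitive t0 g_continuous.
have cFx x : 0 < x <= t -> {within `[0, x], continuous F}.
  move=> /andP[x0 xt]; apply: continuous_subspaceW cF.
  by move=> s /=; rewrite !in_itv/= => /andP[-> sx]; exact: le_trans xt.
exists F; split => // x /[dup] xt' /andP[x0 xt].
  have dFs s : s \in `]0, x[%R -> is_derive s 1 F (g s).
    rewrite in_itv/= => /andP[s0 sx]; apply: dF.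
    by rewrite s0 (lt_le_trans sx).
  have [s] := MVT x0 dFs (cFx _ xt').
  rewrite in_itv/= F0 !subr0 => /andP[s0 sx] ->.
  by rewrite mulr_gt0// g_gt0// ltW//= ltW// (lt_le_trans sx).
have : f 1%N 0 - F 0 <= f 1%N x - F x.
  apply: (@nonneg_derivative_le _ (fun s => f 1%N s - F s)); first exact: ltW.
  - move=> s /andP[s0 sx]; have st : 0 < s < t by rewrite s0 (lt_le_trans sx).
    have [d fd] := solution_derivative k11 tT st.
    rewrite kltk => H; exists (d - g s); last by rewrite subr_ge0.
    exact: (is_deriveB fd (dF s st)).
  - apply: within_continuousB; last exact: cFx.
    by apply: solution_continuous => //; apply: le_lt_trans tT; rewrite lee_fin.
rewrite F0 subr0 lerBrDr; apply: le_trans.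
by rewrite lerDr hf0.
Qed.

Variable F : R -> R.
Hypothesis F0 : F 0 = 0.
Hypothesis cF : {within `[0, t], continuous F}.
Hypothesis dF : forall x, 0 < x < t -> is_derive x 1 F (g x).
Hypothesis F_gt0 : forall x, 0 < x <= t -> 0 < F x.
Hypothesis Ff : forall x, 0 < x <= t -> F x <= f 1%N x.

Let df j x : (1 <= j < k)%N -> 0 < x < t ->
  exists2 d : R, is_derive x 1 (f j) d & C j * f j.+1 x `^ p j <= d.
Proof.
move=> /andP[j1 jk] xt.
have jk' : (1 <= j <= k)%N by rewrite j1 ltnW.
have [d fd H] := solution_derivative jk' tT xt.
by exists d => //; move: H; rewrite jk.
Qed.

Let dfk x : 0 < x < t -> exists2 d : R, is_derive x 1 (f k) d &
  C k * expR (- lam * x) * F x `^ p k <= d.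
Proof.
move=> xt; have [d fd H] := solution_derivative kk tT xt.
exists d => //; apply: le_trans H; rewrite ltnn.
rewrite (ler_wpM2l (mulr_ge0 (ltW (hC kk)) (expR_ge0 _)))//.
apply: (ge0_ler_powR (le_trans ler01 (hp kk))).
- by rewrite nnegrE ltW// F_gt0// innerl.
- by rewrite nnegrE f_ge0// inner.
- exact/Ff/innerl.
Qed.

(** The case j = 2 of the chain, combined with g = C_1 f_2^(p_1). *)
Lemma first_component_speed x : 0 < x < t ->
  kap * expR (- (Lc k p lam 1 * x / Qc k p 1)) *
  (F x + a) `^ (1 + 1 / alpha k p 1) <= g x.
Proof.
move=> xt; have Fx := F_gt0 (innerl xt).
have A1E := Ac_rec hp hC k1k.
apply: root_bound => //.
- exact: Ac_gt0.
- exact: Qc1_gt0.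
- exact: addr_gt0.
- exact/ltW/g_gt0/inner.
have chain := multiplier_chain hk hp hC hlam
  (fun j jk => solution_continuous jk tT) f_ge0 df dfk
  g_continuous g_gt0 g_derivative_ge0 F0 cF F_gt0 dF.
have j22 : (2 <= 2 <= k)%N by rewrite hk.
have H := chain _ _ j22 (inner xt).
have e1 : expR (- (Lc k p lam 2 * x)) <= 1.
  rewrite expR_le1 oppr_le0 mulr_ge0//; last by case/andP: (inner xt).
  exact: Lc_ge0.
have aE : a = Ac k p C 2 `^ (- (1 / Pc k p 2)) * C 1%N `^ (Qc k p 2 / Pc k p 2) *
    f 2%N 0 `^ ((p 1%N * Qc k p 2 + 1) / Pc k p 2).
  by rewrite /a (Qc_rec p kltk).
have := speed_bound_algebra (Ac_gt0 hp hC k22) (hC k11) (Pc_ge1 hp k22)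
  Q2_ge0 p1_ge0 hf2 (f2_gt0 (inner xt)) (ltW Fx) (expR_gt0 _) e1 erefl aE H.
rewrite -(Qc_rec p kltk) -/(g x).
have -> : p 1%N * Pc k p 2 = Pc k p 1 - 1 by rewrite (Pc_rec p kltk) addrK.
have -> : C 1%N * Ac k p C 2 `^ p 1%N = Pc k p 1 * Ac k p C 1.
  by rewrite A1E !mulrA divff ?mul1r// gt_eqF.
rewrite -expRM (Lc_rec p lam kltk).
by rewrite mulNr (mulrC _ (p 1%N)) (mulrA (p 1%N) (Lc k p lam 2)).
Qed.

End UpTo.

(** The weight has a different primitive E according to whether lambda vanishes,
so E is left arbitrary. The auxiliary function F only survives through the
witness y = F(t) + a. *)
Lemma inverse_power_decay (E : R -> R) t : 0 <= t -> (t%:E < T)%E ->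
  {within `[0, t], continuous E} -> E 0 = 0 ->
  (forall x : R, 0 < x < t ->
     is_derive x 1 E (expR (- (Lc k p lam 1 * x / Qc k p 1)))) ->
  exists y, [/\ 0 < y, y <= f 1%N t + a &
    y `^ (- (1 / alpha k p 1)) + LCtilde k p C / Qc k p 1 * E t
    <= a `^ (- (1 / alpha k p 1))].
Proof.
rewrite le_eqVlt => /predU1P[<- _ _ E0 _|t0 tT cE E0 dE].
  by exists a; rewrite E0 mulr0 addr0 lerDr hf0.
have [F [F0 cF dF F_gt0 Ff]] := first_component_minorant t0 tT.
have tt : 0 < t <= t by rewrite t0 lexx.
exists (F t + a); split.
- by rewrite addr_gt0// F_gt0.
- by rewrite lerD2r Ff.
rewrite LCtilde_kap.
have y0 x : 0 <= x <= t -> 0 < F x + a.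
  move=> /andP[]; rewrite le_eqVlt => /predU1P[<- _|x0 xt].
    by rewrite F0 add0r.
  by rewrite addr_gt0// F_gt0// x0.
have cy : {within `[0, t], continuous (fun x => F x + a)}.
  by move=> x; apply: cvgD; [exact: cF|exact: cvg_cst].
have dy x : 0 < x < t -> is_derive x 1 (fun x => F x + a) (g x).
  move=> xt; rewrite -[g x]addr0.
  exact: (is_deriveD (dF x xt) (is_derive_cst a x 1)).
have s0 : 0 < 1 / alpha k p 1 by rewrite divr_gt0// alpha1_gt0.
have := power_comparison (ltW t0) s0 cy cE y0 dy dE
  (first_component_speed tT F0 cF dF F_gt0 Ff).
by rewrite F0 add0r E0 mulr0 addr0.
Qed.
End Solution.

Unset Implicit Arguments.

Theorem proposition2p1 (R : realType) (k : nat) (p C : nat -> R) (lam : R)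
    (T : \bar R) (f : nat -> R -> R)
    (hk : (2 <= k)%N)
    (hp : forall j : nat, (1 <= j <= k)%N -> 1 <= p j)
    (hp1 : exists2 j : nat, (1 <= j <= k)%N & p j != 1)
    (hlam : 0 <= lam)
    (hC : forall j : nat, (1 <= j <= k)%N -> 0 < C j)
    (hT : (0 < T)%E)
    (hsol : solves_inequalities k p C lam T f)
    (hf0 : forall j : nat, (1 <= j <= k)%N -> j != 2%N -> 0 <= f j 0)
    (hf2 : f2_threshold k p C lam < f 2%N 0) :
  forall t : R, 0 <= t -> (t%:E < T)%E ->
    t < T0 k p C lam (f 2%N 0) /\
    f1_lower_bound k p C lam (f 2%N 0) t <= f 1%N t.
Proof.
move=> t t0 tT.
have b0 : 0 < f 2%N 0.
  apply: le_lt_trans hf2; rewrite /f2_threshold; case: ifP => // _.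
  by rewrite !mulr_ge0 ?powR_ge0.
have f_init j : (1 <= j <= k)%N -> 0 <= f j 0.
  by move=> jk; have [->|j2] := eqVneq j 2%N; [exact: ltW|exact: hf0].
have Q0 := Qc1_gt0 hk hp; have LC0 := LCtilde_gt0 hk hp hp1 hC.
have al0 := alpha1_gt0 hk hp hp1.
have decay := inverse_power_decay hk hp hC hlam hp1 hsol f_init b0 t0 tT.
rewrite shift_inverse_power// in decay.
have inverse_gt0 y : 0 < y -> 0 < y `^ (- (1 / alpha k p 1)) by exact: powR_gt0.
rewrite /f1_lower_bound /T0.
(* In both cases the decay estimate bounds y^(-1/alpha_1) by a quantity that has
   the sign of T_0 - t: being positive it forces t < T_0, and inverting the power
   bounds y from below. *)
have [lam0|lam0] := eqVneq lam 0.
  have [||x xt|y [y0 yf]] := decay id.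
  - by apply: continuous_subspaceT => x; exact: cvg_id.
  - by [].
  - rewrite /Lc lam0 !mul0r oppr0 expR0; exact: is_derive_id.
  move=> H; set M := (X in _ <= X) in H.
  rewrite -[X in Qc k p 1 * X]mulrA -(mulrA (LCtilde k p C)^-1).
  rewrite (mulrA (Ac _ _ _ _ `^ _)) -/M.
  set T1 := Qc k p 1 * _.
  have {}H : y `^ (- (1 / alpha k p 1)) <= LCtilde k p C * ((T1 - t) / Qc k p 1).
    have -> : LCtilde k p C * ((T1 - t) / Qc k p 1) =
              M - LCtilde k p C / Qc k p 1 * t.
      by rewrite /T1; field; rewrite !gt_eqF.
    by rewrite lerBrDr.
  have := lt_le_trans (inverse_gt0 _ y0) H.
  rewrite pmulr_rgt0// pmulr_lgt0 ?invr_gt0// subr_gt0 => tT1; split => //.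
  rewrite lerBlDr; apply: le_trans yf.
  rewrite -powRM ?(ltW LC0) ?divr_ge0 ?(ltW Q0) ?subr_ge0 ?(ltW tT1)//.
  exact: inverse_power_bound.
have L0 := Lc1_gt0 hp hlam lam0; have Ct0 := Ctilde_gt0 hk hp hp1 hC hlam lam0.
have := f2_threshold_lt1 hk hp hp1 hC hlam lam0 b0 hf2.
(* 1 - Z is the argument of the logarithm in T_0. *)
set Z := (X in X < 1) => Z1.
set L := Lc k p lam 1 in L0 *; set Q := Qc k p 1 in Q0 *.
have [Ln0 Qn0] : L != 0 /\ Q != 0 by rewrite !gt_eqF.
have dE x := expR_primitive x Ln0 Qn0.
have [||y [y0 yf H]] := decay (fun x => Q / L * (1 - expR (- (L * x / Q)))).
- apply: continuous_subspaceT => x.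
  apply/differentiable_continuous; rewrite -derivable1_diffP.
  by have [] := dE x.
- by rewrite mulr0 mul0r oppr0 expR0 subrr mulr0.
have e1 : expR (- (L * (- L^-1 * Q * ln (1 - Z)) / Q)) = 1 - Z.
  have -> : - (L * (- L^-1 * Q * ln (1 - Z)) / Q) = ln (1 - Z).
    by field; rewrite !gt_eqF.
  by rewrite lnK// posrE subr_gt0.
set T1 := - L^-1 * Q * _ in e1 *.
have {}H : y `^ (- (1 / alpha k p 1)) <=
    Ctilde k p C lam * (expR (- (L * t / Q)) - expR (- (L * T1 / Q))).
  rewrite e1; move: H; rewrite -lerBrDr => H; apply: (le_trans H).
  set M := Ac _ _ _ _ `^ _ * _ * _.
  have -> : Z = (Ctilde k p C lam)^-1 * M by rewrite /Z /M !mulrA.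
  have CE : Ctilde k p C lam = L^-1 * LCtilde k p C by [].
  rewrite CE -/Q le_eqVlt; apply/predU1P; left; field.
  by rewrite ?Ln0 ?Qn0 gt_eqF.
have := lt_le_trans (inverse_gt0 _ y0) H.
rewrite pmulr_rgt0// => /[dup]/ltW diff_ge0.
rewrite subr_gt0 ltr_expR ltrN2 ltr_pM2r ?invr_gt0// ltr_pM2l// => tT1.
split => //.
rewrite lerBlDr; apply: le_trans yf.
rewrite -(powRM _ (ltW Ct0) diff_ge0).
exact: inverse_power_bound.
Qed.
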